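(* For any Tychonoff space $X$, the following are equivalent. (1) $C_{rc}(X)$ is submetrizable. (2) Every $C$-compact subset of $C_{rc}(X)$ is a $G_\delta$-set in $C_{rc}(X)$. (3) Every compact subset of $C_{rc}(X)$ is a $G_\delta$-set in $C_{rc}(X)$. (4) $C_{rc}(X)$ is an $E_0$-space. (5) $X$ is almost $\sigma$-$C$-compact. (6) $C_{rc}(X)$ has a zero-set-diagonal. (7) $C_{rc}(X)$ has a $G_\delta$-diagonal.
   Context: For a space $Y$, $C(Y)$ is the set of all continuous real-valued functions on $Y$, and a subset $A\subseteq Y$ is a $C$-compact subset of $Y$ if $f(A)$ is compact in $\mathbb{R}$ for every $f\in C(Y)$. $C_{rc}(X)$ is $C(X)$ with the $C$-compact-open topology, whose subbase consists of all sets $[A,V]=\{f\in C(X): f(A)\subseteq V\}$ with $A$ a non-empty $C$-compact subset of $X$ and $V\subseteq\mathbb{R}$ open. A space is submetrizable if it admits a weaker (coarser) metrizable topology. A space is an $E_0$-space if every point of it is a $G_\delta$-set. A space $Y$ has a $G_\delta$-diagonal (respectively, a zero-set-diagonal) if $\{(y,y):y\in Y\}$ is a $G_\delta$-set (respectively, a zero-set, i.e. the preimage of $0$ under some continuous real-valued function) in $Y\times Y$. $X$ is almost $\sigma$-$C$-compact if there is a sequence $\{A_n\}$ of $C$-compact subsets of $X$ such that $\bigcup_{n=1}^\infty A_n$ is dense in $X$. *)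

(* Defs.v *)
From HB Require Import structures.
From mathcomp Require Import all_boot all_order all_algebra.
From mathcomp Require Import all_classical all_reals all_analysis.
From mathcomp Require Import borel_hierarchy.

Set Implicit Arguments.
Unset Strict Implicit.
Unset Printing Implicit Defensive.

Import Order.TTheory GRing.Theory Num.Theory.
Import numFieldNormedType.Exports.

Local Open Scope classical_set_scope.
Local Open Scope ring_scope.

(* By uniform_separatorP, completely_regular_space says that points and closed
   sets are separated by continuous functions into [0, 1]. *)
Definition tychonoff_space (X : topologicalType) :=
  completely_regular_space X /\ hausdorff_space X.

Definition C_compact (R : realType) (Y : topologicalType) (A : set Y) :=
  forall f : Y -> R, continuous f -> compact (f @` A).

(* A fresh alias of the type of continuous functions X -> R, so that it can
   carry its own topology. *)
Definition C_rc (R : realType) (X : topologicalType) : Type :=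
  continuousType X R.

Section C_compact_open.
Context (R : realType) (X : topologicalType).

Definition C_rc_subbase : set (set X * set R) :=
  [set AV | [/\ AV.1 !=set0, C_compact R AV.1 & open AV.2]].

Definition C_rc_set (AV : set X * set R) : set (C_rc R X) :=
  [set f : continuousType X R | f @` AV.1 `<=` AV.2].

HB.instance Definition _ := Choice.copy (C_rc R X) (continuousType X R).
HB.instance Definition _ :=
  isSubBaseTopological.Build (C_rc R X) C_rc_subbase C_rc_set.

End C_compact_open.

(* The topological, resp. metric, structures quantified over below live on the
   carrier of Y itself. *)
Definition metrizable (R : realType) (Y : topologicalType) :=
  exists m : Metric.axioms_ R Y,
    forall U : set Y, open U <-> @open (Metric.Pack m) U.

Definition submetrizable (R : realType) (Y : topologicalType) :=
  exists t : Topological.axioms_ Y,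
    metrizable R (Topological.Pack t) /\
    forall U : set Y, @open (Topological.Pack t) U -> open U.

Definition E0_space (Y : topologicalType) :=
  forall y : Y, Gdelta [set y].

Definition zero_set (R : realType) (Y : topologicalType) (A : set Y) :=
  exists2 f : Y -> R, continuous f & A = f @^-1` [set 0].

Definition Gdelta_diagonal (Y : topologicalType) :=
  Gdelta (@diagonal Y).

Definition zero_set_diagonal (R : realType) (Y : topologicalType) :=
  zero_set R (@diagonal Y).

Definition almost_sigma_C_compact (R : realType) (X : topologicalType) :=
  exists2 A : nat -> set X, (forall n, C_compact R (A n)) &
    dense (\bigcup_n A n).

(* Main.v *)
Require Import Defs.
From mathcomp Require Import all_boot all_order all_algebra.
From mathcomp Require Import all_classical all_reals all_analysis.
From mathcomp Require Import borel_hierarchy.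
From HB Require Import structures.
From mathcomp Require Import lra.

(** Submetrizability of a space Y amounts to the existence of a metric d on Y
all of whose balls are neighbourhoods for the topology of Y
([submetrizable_continuous_metric]).  Such a d is continuous on Y * Y, so the
diagonal is its zero set; and every C-compact K is the intersection of the
open sets of points at distance less than 1/(n+1) from some point of K,
because the distances from a fixed point to K form a compact set of reals and
so have 0 as a value as soon as they have 0 as infimum.  Zero sets are
G_delta, and points are slices of the diagonal, hence G_delta when the
diagonal is.

Two links are specific to the space of functions.

From points to X ([E0_almost_sigma_C_compact]): if the zero function is the
intersection of open sets F n, then each F n contains a basic neighbourhood of
0, which constrains functions only on a finite union of C-compact sets.  A
function vanishing on all these unions lies in every F n, so it is 0; by
complete regularity the unions are jointly dense.

From X to a metric ([sup_metric_continuous_metric]): if the C-compact sets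
A n have a dense union, the supremum over n and over x in A n of
min (1/(n+1), |f x - g x|) is a metric, since two continuous functions that
agree on a dense set are equal.  Its balls are neighbourhoods because closeness
on a C-compact set is a neighbourhood condition ([near_C_rc_close]): a
C-compact set is cut by finitely many closed slabs of f into pieces where f is
nearly constant, and the pieces are again C-compact
([C_compact_setI_zero]). *)

Set Implicit Arguments.
Unset Strict Implicit.
Unset Printing Implicit Defensive.

Import Order.TTheory GRing.Theory Num.Theory.
Import numFieldNormedType.Exports.

Local Open Scope classical_set_scope.
Local Open Scope ring_scope.

(** * C-compact sets *)

Section C_compact_sets.
Context (R : realType) (Y : topologicalType).
Implicit Types A B : set Y.

Lemma compact_C_compact A : compact A -> C_compact R A.
Proof.
move=> cA f fc; apply: continuous_compact => //.
exact: continuous_subspaceT.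
Qed.

Lemma C_compact_bigsetU (I : eqType) (s : seq I) (F : I -> set Y) :
  (forall i, i \in s -> C_compact R (F i)) ->
  C_compact R (\big[setU/set0]_(i <- s) F i).
Proof.
move=> cF f fc; elim: s cF => [_|i s IH cF].
  by rewrite big_nil image_set0; exact: compact0.
rewrite big_cons image_setU; apply: compactU.
  by apply: cF => //; exact: mem_head.
by apply: IH => j js; apply: cF; rewrite in_cons js orbT.
Qed.

(** The image of A is closed in the reals and 0 is in its closure.  Taking
for phi a sum of absolute values turns this into an attainment result for
several continuous functions at once. *)
Lemma C_compact_attains_zero A (phi : Y -> R) :
  C_compact R A -> continuous phi ->
  (forall e, 0 < e -> exists2 x, A x & `|phi x| < e) ->
  exists2 x, A x & phi x = 0.
Proof.
move=> cA phic inf0.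
have clo : closed (phi @` A).
  by apply: compact_closed; [exact: Rhausdorff | exact: cA].
have [|x Ax phix] := clo 0; last by exists x.
move=> U /nbhs_ballP[e /= e0 eU].
have [x Ax xe] := inf0 _ e0.
exists (phi x); split; first by exists x.
by apply: eU; rewrite /ball/= sub0r normrN.
Qed.

(** A value t in the closure of the image of A `&` Z under h, where Z is the
zero set of g, is attained because |h - t| + |g| takes arbitrarily small
values on A, hence vanishes at a point of A. *)
Lemma C_compact_setI_zero A (g : Y -> R) :
  C_compact R A -> continuous g -> C_compact R (A `&` g @^-1` [set 0]).
Proof.
move=> cA gc h hc.
apply: (@subclosed_compact _ _ (h @` A)); last 2 first.
- exact: cA.
- by apply: image_subset => x [].
move=> t clt.
pose k x := `|h x - t| + `|g x|.
have [||x Ax kx0] := @C_compact_attains_zero A k cA.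
- move=> x; apply: cvgD; apply: cvg_norm; last exact: gc.
  by apply: cvgB; [exact: hc | exact: cvg_cst].
- move=> e e0.
  have [_ [[x [Ax gx] <-]]] := clt _ (nbhsx_ballx t e e0).
  rewrite /ball/= distrC => hxt; exists x => //.
  by rewrite /k gx normr0 addr0 normr_id.
have /eqP := kx0; rewrite paddr_eq0 // !normr_eq0 subr_eq0.
by move=> /andP[/eqP hx /eqP gx]; exists x.
Qed.

End C_compact_sets.

(** * Metrics coarser than a topology *)

Section continuous_metrics.
Context (R : realType).

(** The last field says that the metric topology is coarser than that of Y;
with the triangle inequality it makes d jointly continuous. *)
Record continuous_metric (Y : topologicalType) (d : Y -> Y -> R) : Prop :=
  ContinuousMetric {
    cmetric_xx : forall x, d x x = 0 ;
    cmetric_eq : forall x y, d x y = 0 -> x = y ;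
    cmetric_sym : forall x y, d x y = d y x ;
    cmetric_triangle : forall y x z, d x z <= d x y + d y z ;
    cmetric_near : forall x e, 0 < e -> \forall y \near x, d x y < e }.

(** A copy of Y, so that the metric structure given by d does not compete with
the topology of Y. *)
Definition metric_carrier (Y : topologicalType) (d : Y -> Y -> R)
  (hd : continuous_metric d) : Type := Y.

Section metric_carrier_instance.
Context (Y : topologicalType) (d : Y -> Y -> R) (hd : continuous_metric d).

HB.instance Definition _ := Choice.on (metric_carrier hd).
HB.instance Definition _ := @isMetric.Build R (metric_carrier hd) d
  (cmetric_xx hd) (cmetric_eq hd) (cmetric_sym hd) (cmetric_triangle hd).

End metric_carrier_instance.

Context (Y : topologicalType).

Lemma submetrizable_continuous_metric :
  submetrizable R Y <-> exists d : Y -> Y -> R, continuous_metric d.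
Proof.
split=> [[t [[m tm] tY]]|[d hd]].
  pose M : metricType R := Metric.Pack m.
  exists (@mdist R M); split.
  - exact: (@metric_structure.mdistxx R M).
  - exact: (@mdist_positivity R M).
  - exact: (@metric_sym R M).
  - by move=> y x z; exact: (@metric_triangle R M).
  move=> x e e0.
  have : nbhs (x : M) [set y : M | mdist (x : M) y < e].
    by rewrite -ballEmdist; exact: nbhsx_ballx.
  rewrite nbhsE => -[U [oU Ux] Ue].
  apply: filterS Ue _; apply: open_nbhs_nbhs; split=> //.
  by apply: tY; apply/tm.
exists (Topological.class (metric_carrier hd)); split.
  by exists (Metric.class (metric_carrier hd)) => U.
move=> U oU; rewrite openE => x Ux; rewrite /interior.
have : nbhs (x : metric_carrier hd) U by exact: open_nbhs_nbhs.
move=> /nbhs_ballP[e /= e0 eU].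
apply: filterS (cmetric_near hd x e0) => y xye.
by apply: eU; rewrite ballEmdist.
Qed.

Context (d : Y -> Y -> R) (hd : continuous_metric d).

Lemma cmetric_ge0 x y : 0 <= d x y.
Proof.
have := cmetric_triangle hd y x x.
by rewrite (cmetric_xx hd) (cmetric_sym hd y x); lra.
Qed.

Lemma cmetric_quadrangle x y x' y' : `|d x y - d x' y'| <= d x x' + d y y'.
Proof.
have := cmetric_triangle hd x' x y; have := cmetric_triangle hd y' x' y.
have := cmetric_triangle hd x x' y'; have := cmetric_triangle hd y x y'.
rewrite (cmetric_sym hd x' x) (cmetric_sym hd y' y) ler_norml.
by move=> *; apply/andP; split; lra.
Qed.

Lemma cmetric_continuous2 : continuous (fun z : Y * Y => d z.1 z.2).
Proof.
move=> [x y]; apply/cvgrPdist_lt => e e0 /=.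
have e20 : 0 < e / 2 by rewrite divr_gt0.
exists ([set x' | d x x' < e / 2], [set y' | d y y' < e / 2]).
  by split; exact: (cmetric_near hd).
move=> [x' y'] /= [dx dy]; apply: (le_lt_trans (cmetric_quadrangle _ _ _ _)).
by rewrite [ltRHS]splitr ltrD.
Qed.

Lemma cmetric_continuous y : continuous (d y).
Proof.
move=> x; apply/cvgrPdist_lt => e e0.
apply: filterS (cmetric_near hd x e0) => x' xx' /=.
apply: (le_lt_trans (cmetric_quadrangle _ _ _ _)).
by rewrite (cmetric_xx hd) add0r.
Qed.

(** A point z in all the 1/(n+1)-neighbourhoods of K has distance 0 to some
point of K, by [C_compact_attains_zero] applied to the distance to z. *)
Lemma cmetric_C_compact_Gdelta (K : set Y) : C_compact R K -> Gdelta K.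
Proof.
move=> cK.
exists (fun n => \bigcup_(k in K) d k @^-1` [set r | r < n.+1%:R^-1]).
  move=> n; apply: bigcup_open => k _.
  apply: open_comp => [x _|]; first exact: cmetric_continuous.
  exact: open_lt.
apply/seteqP; split=> [k Kk n _|z Hz].
  by exists k => //=; rewrite (cmetric_xx hd) invr_gt0.
have [|e e0|k Kk dzk] := @C_compact_attains_zero _ _ K (d z) cK.
- exact: cmetric_continuous.
- have [n] := ltr_add_invr e0; rewrite add0r => ne.
  have [k Kk /= kz] := Hz n I; exists k => //.
  by rewrite ger0_norm ?cmetric_ge0 // (cmetric_sym hd) (lt_trans kz).
by rewrite (cmetric_eq hd dzk).
Qed.

Lemma cmetric_zero_set_diagonal : zero_set_diagonal R Y.
Proof.
exists (fun z : Y * Y => d z.1 z.2); first exact: cmetric_continuous2.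
apply/seteqP; split=> -[x y] /=; last exact: (cmetric_eq hd).
by rewrite /diagonal /= => ->; exact: (cmetric_xx hd).
Qed.

End continuous_metrics.

(** * G_delta sets *)

Section Gdelta_sets.

Lemma Gdelta_preimage (S T : topologicalType) (f : S -> T) (B : set T) :
  continuous f -> Gdelta B -> Gdelta (f @^-1` B).
Proof.
move=> fc [F oF ->]; exists (fun n => f @^-1` F n).
  by move=> n; apply: open_comp => // x _; exact: fc.
by rewrite preimage_bigcap.
Qed.

Lemma zero_set_Gdelta (R : realType) (Y : topologicalType) (A : set Y) :
  zero_set R A -> Gdelta A.
Proof.
move=> [f fc ->]; apply: Gdelta_preimage => //.
exists (fun n => ball (0 : R) n.+1%:R^-1) => [n|]; first exact: ball_open.
apply/seteqP; split=> [_ -> n _|r Hr]; first exact: ballxx.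
apply: contrapT => /eqP r0.
have : 0 < `|r| by rewrite normr_gt0.
move=> /ltr_add_invr[n]; rewrite add0r => nr.
have := Hr n I; rewrite /ball /= sub0r normrN => rn.
by have := lt_trans nr rn; rewrite ltxx.
Qed.

Lemma Gdelta_diagonal_E0 (Y : topologicalType) :
  Gdelta_diagonal Y -> E0_space Y.
Proof.
move=> dY y.
have -> : [set y] = (fun z => (z, y)) @^-1` (@diagonal Y).
  by apply/seteqP; split=> z.
apply: Gdelta_preimage => // z.
by apply: cvg_pair; [exact: cvg_id | exact: cvg_cst].
Qed.

End Gdelta_sets.

(** * Neighbourhoods in the C-compact-open topology *)

Section function_space.
Context (R : realType) (X : topologicalType).

Lemma C_rc_subbase_open AV : C_rc_subbase AV -> open (@C_rc_set R X AV).
Proof.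
move=> hAV.
exists [set @C_rc_set R X AV]; last by rewrite bigcup_set1.
by move=> _ ->; exact: finI_from1.
Qed.

Lemma C_rc_open_subbase (U : set (C_rc R X)) (f : C_rc R X) : open U -> U f ->
  exists s : seq (set X * set R),
    [/\ forall AV, AV \in s -> C_rc_subbase AV /\ C_rc_set AV f &
        forall g, (forall AV, AV \in s -> C_rc_set AV g) -> U g].
Proof.
move=> [D DU <-] [W DW] Wf.
have [s sub sW] := DU W DW.
exists (finmap.enum_fset s); split=> [AV AVs|g gs].
  split; first by apply/set_mem; exact: sub.
  by move: Wf; rewrite /= -sW; exact.
by exists W => //; rewrite /= -sW => AV AVs; exact: gs.
Qed.

(** The C-compact-open topology refines uniform convergence on C-compact sets.
Compactness of the image of A under f reduces this to the points of A whose
value is close to a given t0.  With r = e / 3, those within the closed slab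
|f - t0| <= r form a C-compact set B, and mapping B into the open ball of
radius 2 r around t0 is a subbasic condition that f satisfies and that keeps g
within r + 2 r = e of f on B. *)
Lemma near_C_rc_close (A : set X) (f : C_rc R X) (e : R) :
  C_compact R A -> 0 < e ->
  \forall g \near f, forall x, A x ->
    `|(f : continuousType X R) x - (g : continuousType X R) x| <= e.
Proof.
move=> cA e0; pose F : X -> R := (f : continuousType X R).
have Fc : continuous F by exact: cts_fun.
have /compact_near_coveringP cov : compact (F @` A) by exact: cA.
pose P (g : C_rc R X) t := forall x, A x -> F x = t ->
  `|F x - (g : continuousType X R) x| <= e.
have : \forall g \near f, F @` A `<=` P g.
  apply: (cov _ (nbhs f) P) => t0 _.
  pose r := e / 3; have r0 : 0 < r by rewrite divr_gt0.
  pose B := A `&` (fun x => Num.max (`|F x - t0| - r) 0) @^-1` [set 0].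
  have BE x : B x <-> A x /\ `|F x - t0| <= r.
    rewrite /B /=; split=> -[Ax].
      by move=> /max_idPr; rewrite subr_le0.
    by move=> xt; split=> //; apply/max_idPr; rewrite subr_le0.
  have cB : C_compact R B.
    apply: C_compact_setI_zero => // x.
    apply: (@continuous_max R X (fun x => `|F x - t0| - r) (fun=> 0)).
      apply: cvgB; last exact: cvg_cst.
      by apply: cvg_norm; apply: cvgB; [exact: Fc | exact: cvg_cst].
    exact: cvg_cst.
  have gB : \forall g \near f, forall x, B x ->
      `|t0 - (g : continuousType X R) x| < 2 * r.
    (* Only non-empty sets index the subbase. *)
    have [->|B0] := eqVneq B set0; first by apply: filterS filterT => g _ x.
    apply: filterS (_ : nbhs f (C_rc_set (B, ball t0 (2 * r)))).
      by move=> g gB x Bx; apply: gB; exists x.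
    apply: open_nbhs_nbhs; split.
      apply: C_rc_subbase_open; split=> //=; first exact/set0P.
      exact: ball_open.
    move=> _ [x /BE[_ xt] <-]; rewrite /ball /= distrC.
    by rewrite /F in xt *; lra.
  exists (ball t0 r, [set g : C_rc R X | forall x, B x ->
      `|t0 - (g : continuousType X R) x| < 2 * r]).
    by split=> //; exact: nbhsx_ballx.
  move=> [t g] /= [tt0 {}gB] x Ax Fx.
  have Fxt : `|F x - t0| <= r by rewrite Fx distrC ltW.
  have := gB x; rewrite BE => /(_ (conj Ax Fxt)) gxt.
  apply: (le_trans (ler_distD t0 _ _)).
  by have -> : e = r + 2 * r; [rewrite /r; lra | rewrite lerD // ltW].
by apply: filterS => g H x Ax; apply: (H (F x)) => //; exists x.
Qed.

(** * Points that are G_delta *)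

(** If an open set O misses the constrained sets, a function that is 1 at a
point of O and 0 outside O obeys the same constraints as the zero function. *)
Lemma E0_almost_sigma_C_compact : completely_regular_space X ->
  E0_space (C_rc R X) -> almost_sigma_C_compact R X.
Proof.
move=> crX E0.
pose z : continuousType X R := mkcts (@cst_continuous X R 0).
have [F oF zF] := E0 (z : C_rc R X).
have Fz n : F n (z : C_rc R X).
  have : (\bigcap_i F i) (z : C_rc R X) by rewrite -zF.
  exact.
have [s sP] := choice (fun n => C_rc_open_subbase (oF n) (Fz n)).
pose B n := \big[setU/set0]_(AV <- s n) AV.1.
exists B => [n|].
  apply: C_compact_bigsetU => AV AVs.
  by have [/(_ _ AVs)[[]]] := sP n.
move=> O [x Ox] oO; apply: contrapT => OB.
have [f [fc _ fx fO]] : exists f : X -> R,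
    [/\ continuous f, range f `<=` `[0, 1],
    [set f y | y in [set x]] `<=` [set 0] & [set f y | y in ~` O] `<=` [set 1]].
  by apply/uniform_separatorP; apply: crX => //; exact: open_closedC.
have hc : continuous (fun y => 1 - f y).
  by move=> y; apply: cvgB; [exact: cvg_cst | exact: fc].
pose h : continuousType X R := mkcts hc.
suff : (\bigcap_i F i) (h : C_rc R X).
  rewrite -zF => hz.
  have : 1 - f x = 0 := congr1 (fun k : continuousType X R => k x) hz.
  rewrite (fx (f x)) ?subr0; last by exists x.
  by move/eqP; rewrite oner_eq0.
move=> n _; have [sub] := sP n; apply => AV AVs _ [a Aa <-].
have Oa : ~ O a.
  move=> Oa; apply: OB; exists a; split=> //; exists n => //.
  by rewrite /B -bigcup_seq; exists AV.
have [_ zAV] := sub _ AVs.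
have -> : h a = z a.
  transitivity (1 - f a) => //; rewrite (fO (f a)) ?subrr //; exact: imageP.
by apply: zAV; exists a.
Qed.

(** * The metric given by a dense sequence of C-compact sets *)

Section sup_metric.
Variable A : nat -> set X.

(** The value 0 is adjoined so that the supremum is that of a non-empty set
even if all the sets [A n] are empty.  The bound 1/(n+1) leaves only finitely
many [A n] to control when looking for points at distance less than e. *)
Definition truncated_gaps (f g : X -> R) : set R :=
  [set r | r = 0 \/
    exists n x, A n x /\ r = Num.min n.+1%:R^-1 `|f x - g x|].

Definition sup_metric (f g : X -> R) := sup (truncated_gaps f g).

Lemma truncated_gaps_ubound f g : has_ubound (truncated_gaps f g).
Proof.
exists 1 => _ [->|[n [x [_ ->]]]]; first exact: ler01.
by rewrite ge_min invf_le1 ?ltr0n // ler1n.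
Qed.

Lemma sup_metric_ge0 f g : 0 <= sup_metric f g.
Proof. by apply: ub_le_sup; [exact: truncated_gaps_ubound | left]. Qed.

Lemma truncated_gap_le_sup f g n x : A n x ->
  Num.min n.+1%:R^-1 `|f x - g x| <= sup_metric f g.
Proof.
move=> Ax; apply: ub_le_sup; first exact: truncated_gaps_ubound.
by right; exists n, x.
Qed.

Lemma sup_metric_le f g e : 0 <= e ->
  (forall n x, A n x -> Num.min n.+1%:R^-1 `|f x - g x| <= e) ->
  sup_metric f g <= e.
Proof.
move=> e0 gap; apply: ge_sup; first by exists 0; left.
by move=> _ [->//|[n [x [Ax ->]]]]; exact: gap.
Qed.

Lemma sup_metric_sym f g : sup_metric f g = sup_metric g f.
Proof.
by apply/eqP; rewrite eq_le; apply/andP; split;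
  apply: sup_metric_le (sup_metric_ge0 _ _) _ => n x Ax;
  rewrite distrC truncated_gap_le_sup.
Qed.

Lemma sup_metric_triangle g f h :
  sup_metric f h <= sup_metric f g + sup_metric g h.
Proof.
apply: sup_metric_le => [|n x Ax]; first by rewrite addr_ge0 ?sup_metric_ge0.
have fgA := truncated_gap_le_sup f g Ax.
have ghA := truncated_gap_le_sup g h Ax.
apply: le_trans (lerD fgA ghA).
have c0 : 0 < n.+1%:R^-1 :> R by rewrite invr_gt0.
have := ler_distD (g x) (f x) (h x).
have := normr_ge0 (f x - g x); have := normr_ge0 (g x - h x).
move: (`|f x - g x|) (`|g x - h x|) (`|f x - h x|) (n.+1%:R^-1) c0.
move=> a b c m m0 b0 a0 tri.
by case: (leP m a) => ?; case: (leP m b) => ?; case: (leP m c) => ?; lra.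
Qed.

Lemma sup_metric_eq0 f g n x : sup_metric f g = 0 -> A n x -> f x = g x.
Proof.
move=> d0 Ax; have := truncated_gap_le_sup f g Ax.
rewrite d0 ge_min lt_geF ?invr_gt0 //= normr_le0 subr_eq0.
by move/eqP.
Qed.

(** For n >= N with 1/(N+1) < e / 2 the truncation alone gives a gap below e,
so closeness on the C-compact union of the [A n] with n < N is enough. *)
Lemma sup_metric_continuous_metric :
  (forall n, C_compact R (A n)) -> dense (\bigcup_n A n) ->
  continuous_metric (fun f g : C_rc R X =>
    sup_metric (f : continuousType X R) (g : continuousType X R)).
Proof.
move=> cA dA; split.
- move=> f; apply/eqP; rewrite eq_le sup_metric_ge0 andbT.
  by apply: sup_metric_le => // n x _; rewrite subrr normr0 ge_min lexx orbT.
- move=> f g fg0; apply/continuousEP => x; apply: contrapT => /eqP fgx.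
  (* f and g differ on a non-empty open set, which meets some A n. *)
  pose u y := (f : continuousType X R) y - (g : continuousType X R) y.
  have uc : continuous u.
    by move=> y; apply: cvgB; exact: cts_fun.
  have [||y [uy [n _ Ay]]] := dA (u @^-1` [set r | r != 0]).
  + by exists x; rewrite /= subr_eq0.
  + by apply: open_comp => [y _|]; [exact: uc | exact: open_neq].
  + by move: uy; rewrite /= /u (sup_metric_eq0 fg0 Ay) subrr eqxx.
- by move=> f g; exact: sup_metric_sym.
- by move=> f g h; exact: sup_metric_triangle.
move=> f e e0; have e20 : 0 < e / 2 by rewrite divr_gt0.
have [N] := ltr_add_invr e20; rewrite add0r => Ne.
have cB : C_compact R (\big[setU/set0]_(n <- iota 0 N) A n).
  by apply: C_compact_bigsetU.
apply: filterS (near_C_rc_close f cB e20) => g fg.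
apply: (@le_lt_trans _ _ (e / 2)).
  2: by rewrite ltr_pdivrMr // ltr_pMr // ltr1n.
apply: sup_metric_le (ltW e20) _ => n x Ax; rewrite ge_min; apply/orP.
have [nN|Nn] := ltnP n N.
  right; apply: fg; rewrite -bigcup_seq; exists n => //=.
  by rewrite mem_iota.
left; apply: le_trans (ltW Ne).
by rewrite lef_pV2 ?posrE ?ltr0n // ler_nat.
Qed.

End sup_metric.

Lemma almost_sigma_C_compact_continuous_metric :
  almost_sigma_C_compact R X ->
  exists d : C_rc R X -> C_rc R X -> R, continuous_metric d.
Proof.
by move=> [A cA dA]; eexists; exact: sup_metric_continuous_metric cA dA.
Qed.

End function_space.

Theorem theorem5p4 (R : realType) (X : topologicalType)
    (hX : tychonoff_space X) :
  [<-> submetrizable R (C_rc R X);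
       forall K : set (C_rc R X), C_compact R K -> Gdelta K;
       forall K : set (C_rc R X), compact K -> Gdelta K;
       E0_space (C_rc R X);
       almost_sigma_C_compact R X;
       zero_set_diagonal R (C_rc R X);
       Gdelta_diagonal (C_rc R X)].
Proof.
have [crX _] := hX.
tfae.
- move=> /submetrizable_continuous_metric[d hd] K.
  exact: cmetric_C_compact_Gdelta hd K.
- by move=> H K cK; apply: H; exact: compact_C_compact.
- by move=> H y; apply: H; exact: compact_set1.
- exact: E0_almost_sigma_C_compact.
- move=> /almost_sigma_C_compact_continuous_metric[d hd].
  exact: cmetric_zero_set_diagonal hd.
- exact: zero_set_Gdelta.
- move=> /Gdelta_diagonal_E0 /(E0_almost_sigma_C_compact crX) asX.
  apply/submetrizable_continuous_metric.
  exact: almost_sigma_C_compact_continuous_metric.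
Qed.
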